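(* Let $L$ be a lattice with a smallest element $\delta_0$, and let $I(L)$ be the set of ideals of $L$ (including the empty one), with the topology induced from the product topology on $\{0,1\}^L$. Then $I(L)\setminus\{\emptyset\}$ is a compactification for $L$, where $L$ is included into $I(L)$ via $a\mapsto F_a=\{b\in L:b\preceq a\}$.
   Context: An ideal of $L$ is a subset $F\subset L$ that is downwards closed ($a\preceq b$ and $b\in F$ imply $a\in F$) and closed under joins ($a,b\in F$ implies $a\lor b\in F$); the empty set counts as an ideal. For $a\in L$, $F_a=\{b\in L:b\preceq a\}$ is called a principal ideal. A subset of $L$ is identified with its characteristic function, so $I(L)\subset\{0,1\}^L$; $\{0,1\}^L$ carries the product topology (with $\{0,1\}$ discrete) and $I(L)$ the subspace topology. Being a compactification for $L$ means: $I(L)\setminus\{\emptyset\}$ is a compact Hausdorff space in which the image of the injective map $a\mapsto F_a$ is dense. *)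

(* Defs.v *)
From mathcomp Require Import all_boot all_order.
From mathcomp Require Import all_classical.
From mathcomp Require Import topology.

Set Implicit Arguments.
Unset Strict Implicit.
Unset Printing Implicit Defensive.

Import Order.TTheory.
Local Open Scope order_scope.
Local Open Scope classical_set_scope.

(* The space {0,1}^L; the library's topology on bool is discrete. *)
Notation cube L := (prod_topology (fun _ : L => bool)).

Section Ideals.
Context {d : Order.disp_t} {L : latticeType d}.

(* F is identified with its characteristic function L -> bool; the empty set
   is allowed. *)
Definition is_ideal (F : cube L) : Prop :=
  (forall a b : L, a <= b -> F b -> F a) /\
  (forall a b : L, F a -> F b -> F (a `|` b)%O).

Definition ideals : set (cube L) := [set F | is_ideal F].

Definition empty_ideal : cube L := fun _ => false.

(* As a type (coercion [set_type]), this carries the topology induced from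
   [cube L]. *)
Definition nonempty_ideals : set (cube L) := ideals `\ empty_ideal.

Definition principal_ideal (a : L) : cube L := fun b => b <= a.

Lemma principal_idealP (a : L) : nonempty_ideals (principal_ideal a).
Proof.
split; first split=> [x y xy ya|x y xa ya].
- exact: le_trans xy ya.
- by rewrite /principal_ideal leUx; apply/andP.
- move=> /= /(congr1 (fun F : L -> bool => F a)).
  by rewrite /principal_ideal /empty_ideal lexx.
Qed.

Definition principal (a : L) : nonempty_ideals :=
  SigSub (mem_set (principal_idealP a)).

End Ideals.

Arguments ideals {d} L.
Arguments nonempty_ideals {d} L.

Definition is_compactification (X : Type) (K : topologicalType) (f : X -> K)
    : Prop :=
  [/\ compact [set: K], hausdorff_space K, injective f & dense (range f)].

(* Main.v *)
Require Import Defs.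
From mathcomp Require Import all_boot all_order.
From mathcomp Require Import all_classical.
From mathcomp Require Import topology.

(** In the Cantor cube [cube L] a neighbourhood of a point only constrains
    finitely many coordinates, and convergence means that each coordinate is
    eventually constant.

    Compactness: the bottom element lies in every nonempty ideal, so among
    ideals being nonempty is the condition that the coordinate at [\bot] is
    [true].  Hence nonempty ideals are described by conditions each of which
    involves at most three coordinates; such a set is closed in the cube
    ([nonempty_ideals_closed]), which is compact by Tychonoff's theorem.  Without
    a bottom element this fails: nonempty ideals may converge to the empty one.
    The Hausdorff property is inherited from the cube.

    Density: a nonempty ideal [F] is directed upwards by joins, and along this
    directed set the principal ideals of the elements of [F] converge to [F]
    ([principal_ideal_cvg]), since each coordinate is eventually constant.
    Injectivity is antisymmetry of the order. *)

Import Order.TTheory.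
Local Open Scope order_scope.
Local Open Scope classical_set_scope.

Section SubspaceType.
Context {X : topologicalType}.
Implicit Types A : set X.

Lemma compact_set_type A : compact A -> compact [set: A].
Proof.
move=> cptA F PF _.
have [|x [Ax clx]] := cptA ((set_val : A -> X) @ F) _.
  apply: (@filterS _ F _ setT); last exact: filterT.
  by move=> y _; exact: set_valP.
exists (SigSub (mem_set Ax)); split=> // P Q FP [_ [[W oW <-] Wx WQ]].
have [_ [[y Py <-] Wy]] : set_val @` P `&` W !=set0.
  apply: clx; last exact: open_nbhs_nbhs.
  by apply: (@filterS _ F _ P) => // y Py; exists y.
by exists y; split=> //; exact: WQ.
Qed.

Lemma hausdorff_set_type A : hausdorff_space X -> hausdorff_space A.
Proof.
move=> hX p q pq; apply: val_inj; apply: hX => U V Up Vq.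
have cval : continuous (set_val : A -> X) by exact: initial_continuous.
have [y [Uy Vy]] := pq _ _ (cval p _ Up) (cval q _ Vq).
by exists (set_val y).
Qed.

End SubspaceType.

Section Cube.
Context {I : eqType}.

Lemma near_coord (F : cube I) (i : I) : \forall G \near F, G i = F i.
Proof.
have : nbhs (F i) [set F i] by exact/principal_filterP.
exact: (@proj_continuous I (fun=> bool) i F).
Qed.

Lemma cvg_cube (T : Type) (G : set_system T) (u : T -> cube I) (F : cube I) :
  Filter G -> (forall i, \forall t \near G, u t i = F i) -> u @ G --> F.
Proof.
move=> FG uF; apply/cvg_sup => i A [_ [[B oB <-] BF sB]].
by apply: filterS (uF i) => t utF; apply: sB; rewrite /= utF.
Qed.

End Cube.

Lemma cube_hausdorff (I : eqType) : hausdorff_space (cube I).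
Proof. by apply: hausdorff_product => ?; exact: discrete_hausdorff. Qed.

Lemma cube_compact (I : eqType) : compact [set: cube I].
Proof.
have := @tychonoff I _ _ (fun=> bool_compact).
by congr compact; apply/seteqP; split.
Qed.

Section NonemptyIdeals.
Context {d : Order.disp_t} {L : bLatticeType d}.
Implicit Types F : cube L.

Lemma nonempty_idealsP F : nonempty_ideals L F <-> is_ideal F /\ F \bot.
Proof.
split=> [[idF F0]|[idF Fbot]]; split=> //; last first.
  by move=> FE; move: Fbot; rewrite FE.
apply: contrapT => nFbot; apply: F0; apply: funext => a /=.
by apply/negbTE/negP => /(idF.1 \bot a (le0x a)).
Qed.

(** Any three coordinates of a point of the closure agree with those of some
    nonempty ideal, and the defining conditions only see three coordinates. *)
Lemma nonempty_ideals_closed : closed (nonempty_ideals L).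
Proof.
move=> F clF.
have agree a b c : exists2 G, nonempty_ideals L G &
    [/\ G a = F a, G b = F b & G c = F c].
  have [G [idG [[Ga Gb] Gc]]] := clF _
    (filterI (filterI (near_coord F a) (near_coord F b)) (near_coord F c)).
  by exists G.
apply/nonempty_idealsP; split; first split=> [a b ab|a b].
- have [G [[+ _] _] [<- <- _]] := agree a b b; exact.
- have [G [[_ +] _] [<- <- <-]] := agree a b (a `|` b)%O; exact.
- by have [G /nonempty_idealsP[_ ?] [<- _ _]] := agree \bot \bot \bot.
Qed.

(** This plays the role of a net indexed by [F], which is directed upwards when
    [F] is a nonempty ideal. *)
Definition ideal_tails F : set_system L :=
  filter_from F (fun a => [set c | F c /\ a <= c]).

Lemma ideal_tails_proper F : nonempty_ideals L F -> ProperFilter (ideal_tails F).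
Proof.
move=> /nonempty_idealsP[[_ joinF] Fbot]; apply: filter_from_proper.
  apply: filter_from_filter; first by exists \bot.
  move=> a b Fa Fb; exists (a `|` b)%O; first exact: joinF.
  by move=> c [Fc]; rewrite leUx => /andP[ac bc].
by move=> a Fa; exists a.
Qed.

(** The coordinate at [b] of the principal ideal of [c] in [F] is [true] as
    soon as [c] is above [b] when [b] lies in [F], and always [false]
    otherwise because [F] is downward closed. *)
Lemma principal_ideal_cvg F : nonempty_ideals L F ->
  (@principal_ideal d L) @ ideal_tails F --> F.
Proof.
move=> neF; have PF := ideal_tails_proper F neF.
have [[downF _] Fbot] := (nonempty_idealsP F).1 neF.
apply: cvg_cube => b; case Fb : (F b).
  by exists b => // c [].
exists \bot => // c [Fc _]; apply/negbTE/negP => bc.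
by move: (downF _ _ bc Fc); rewrite Fb.
Qed.

Lemma principal_inj : injective (@principal d L).
Proof.
move=> a b /(congr1 val) /= eqab; apply/eqP; rewrite eq_le.
have eqc c : (c <= a) = (c <= b) := congr1 (fun F : cube L => F c) eqab.
by rewrite -eqc lexx eqc lexx.
Qed.

Lemma dense_principal : dense (range (@principal d L)).
Proof.
move=> O [F OF] [W oW WO]; rewrite -WO in OF *.
have PF := ideal_tails_proper (val F) (set_valP F).
have [a Wa] : exists a, W (principal_ideal a).
  apply: (@filter_ex _ (ideal_tails (val F))).
  by apply: (principal_ideal_cvg (val F) (set_valP F)); exact: open_nbhs_nbhs.
by exists (principal a); split=> //; exists a.
Qed.

End NonemptyIdeals.

Theorem lemma3p4 (d : Order.disp_t) (L : bLatticeType d) :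
  is_compactification (fun a : L => principal a : nonempty_ideals L).
Proof.
split.
- apply: compact_set_type.
  exact: subclosed_compact nonempty_ideals_closed (cube_compact L) _.
- exact/hausdorff_set_type/cube_hausdorff.
- exact: principal_inj.
- exact: dense_principal.
Qed.
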